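(* For each deterministic algorithm $A$ for Metric $1$-median that makes $o(n)$ queries on $n$-point inputs, there exists a computable function $f\colon\mathbb{Z}^+\to\mathbb{Z}^+$ with $f(n)=\omega(1)$ such that $A$ is not $g(n)$-approximate for any function $g(n)=o(f(n)\cdot\log n)$.
   Context: Metric $1$-median: given an $n$-point metric space $(M,d)$ (the point set $M$ is known to the algorithm, while $d$ is accessible only through queries, each query asking for $d(x,y)$ for some $x,y\in M$, possibly chosen adaptively), output a point $p\in M$. An algorithm is $\gamma(n)$-approximate if on every $n$-point metric space its output $p$ satisfies $\sum_{y\in M}d(p,y)\le\gamma(n)\min_{q\in M}\sum_{y\in M}d(q,y)$. *)

(* Defs.v *)
From mathcomp Require Import all_boot all_order all_algebra.
From mathcomp Require Import all_classical all_reals all_analysis.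

Set Implicit Arguments.
Unset Strict Implicit.
Unset Printing Implicit Defensive.

Import Order.TTheory GRing.Theory Num.Theory.
Import numFieldNormedType.Exports.

(* Kleene's partial recursive functions. Arities are not enforced:
   [RSucc] and [RProj] read a missing argument as 0, and [RPrim] is undefined
   on the empty list of arguments. *)
Inductive recfun : Type :=
| RZero
| RSucc
| RProj of nat
| RComp of recfun & seq recfun
| RPrim of recfun & recfun
| RMin of recfun.

(* [rec_eval e v y]: [e] is defined on the arguments [v], with value [y].
   In [eval_min], [w] lists the predecessors of the (nonzero) values taken by
   [e] before its first zero. *)
Inductive rec_eval : recfun -> seq nat -> nat -> Prop :=
| eval_zero v : rec_eval RZero v 0
| eval_succ v : rec_eval RSucc v (head 0 v).+1
| eval_proj i v : rec_eval (RProj i) v (nth 0 v i)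
| eval_comp e es v ws y :
    rec_evals es v ws -> rec_eval e ws y -> rec_eval (RComp e es) v y
| eval_prim0 e1 e2 v y :
    rec_eval e1 v y -> rec_eval (RPrim e1 e2) (0 :: v) y
| eval_primS e1 e2 n v z y :
    rec_eval (RPrim e1 e2) (n :: v) z -> rec_eval e2 [:: n, z & v] y ->
    rec_eval (RPrim e1 e2) (n.+1 :: v) y
| eval_min e v n (w : nat -> nat) :
    (forall m, m < n -> rec_eval e (m :: v) (w m).+1) ->
    rec_eval e (n :: v) 0 -> rec_eval (RMin e) v n
with rec_evals : seq recfun -> seq nat -> seq nat -> Prop :=
| evals_nil v : rec_evals [::] v [::]
| evals_cons e es v y ys :
    rec_eval e v y -> rec_evals es v ys -> rec_evals (e :: es) v (y :: ys).

(* The functions Z^+ -> Z^+ are represented by functions on [nat] whose value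
   at 0 is irrelevant. *)
Definition computable_posfun (f : nat -> nat) : Prop :=
  exists e : recfun, forall n, 0 < n -> rec_eval e [:: n] (f n).

Local Open Scope classical_set_scope.
Local Open Scope ring_scope.

Record is_metric (R : realType) (n : nat) (d : 'I_n -> 'I_n -> R) : Prop := {
  metric_ge0 : forall x y, 0 <= d x y ;
  metric_eq0 : forall x y, d x y = 0 <-> x = y ;
  metric_sym : forall x y, d x y = d y x ;
  metric_triangle : forall x y z, d x z <= d x y + d y z }.

Inductive move (n : nat) : Type :=
| Query of 'I_n & 'I_n
| Output of 'I_n.

(* A deterministic algorithm, given by its next move as a function of the
   number of points and of the answers received so far. [A n] is the behaviour
   on inputs with [n.+1] points: there is no output on an empty point set. *)
Definition algorithm (R : realType) : Type :=
  forall n : nat, seq R -> move n.+1.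

Section Runs.
Variables (R : realType) (A : algorithm R).

(* The answers received during the first [k] moves; the run stops at the first
   [Output]. *)
Fixpoint answers n (d : 'I_n.+1 -> 'I_n.+1 -> R) (k : nat) : seq R :=
  if k is k'.+1 then
    let h := answers d k' in
    match A n h with
    | Query x y => rcons h (d x y)
    | Output _ => h
    end
  else [::].

Definition outputs_within n (d : 'I_n.+1 -> 'I_n.+1 -> R) (k : nat)
    (p : 'I_n.+1) : Prop :=
  A n (answers d k) = Output p.

Definition query_bound (q : nat -> nat) : Prop :=
  forall n (d : 'I_n.+1 -> 'I_n.+1 -> R), is_metric d ->
    exists p, outputs_within d (q n.+1) p.

Definition makes_sublinear_queries : Prop :=
  exists q : nat -> nat, query_bound q /\
    (fun n => (q n)%:R : R) =o_\oo (fun n => n%:R : R).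

Definition cost n (d : 'I_n -> 'I_n -> R) (p : 'I_n) : R := \sum_y d p y.

Definition min_cost n (d : 'I_n.+1 -> 'I_n.+1 -> R) : R :=
  \big[Num.min/cost d ord0]_q cost d q.

Definition approximate (g : nat -> R) : Prop :=
  forall n (d : 'I_n.+1 -> 'I_n.+1 -> R), is_metric d ->
    exists k p, outputs_within d k p /\ cost d p <= g n.+1 * min_cost d.

End Runs.

(* Signs are dropped: this is only used for distances. *)
Definition code_answers (s : seq rat) : nat :=
  CodeSeq.code (flatten [seq [:: `|numq a|%N; `|denq a|%N] | a <- s]).

Definition code_move n (m : move n) : nat :=
  match m with
  | Query x y => CodeSeq.code [:: x : nat; y : nat]
  | Output p => CodeSeq.code [:: p : nat]
  end.

(* A single partial recursive function gives the next move, uniformly in the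
   number of points, whenever the answers received are rational, i.e. finitely
   presented. Nothing is required on histories that no metric space can
   produce. *)
Definition computable_algorithm (R : realType) (A : algorithm R) : Prop :=
  exists e : recfun,
    forall n (d : 'I_n.+1 -> 'I_n.+1 -> R) (k : nat) (s : seq rat),
      is_metric d -> answers A d k = [seq ratr a | a <- s] ->
      rec_eval e [:: n.+1; code_answers s] (code_move (A n (answers A d k))).

(* Main.v *)
Require Import Defs.
From mathcomp Require Import all_boot all_order all_algebra.
From mathcomp Require Import all_classical all_reals all_analysis.
From mathcomp Require Import zify ring lra.
Import Order.TTheory GRing.Theory Num.Theory.
Import numFieldNormedType.Exports.

Set Implicit Arguments.
Unset Strict Implicit.
Unset Printing Implicit Defensive.

(** An adversary keeps a weighted graph [G] and a height [H x], the distance from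
[x] to a hub, and answers a query [(x, y)] by the smaller of the distance in [G]
and the detour [H x + H y]; in the latter case the edge [(x, y)] joins [G].
A vertex of degree [k] has height at least [radius k], roughly [log k], and [H]
is the least 1-Lipschitz function with this property, so that [H] only grows and
no answer is ever contradicted. The levels are tuned by a Catalan-like sequence
[growth]: a ball of radius [r] has at most [growth r <= 2 * 8 ^ r] points, while
raising a vertex of degree [k] to its height affects at most [k + 1] points.
Hence after [k] queries the heights sum to [O(k)], and yet the output [p] can be
lifted to height [L] of order [log n] at an extra cost of [8 ^ L <= sqrt n].
Putting all untouched points next to the hub, [p] costs about [n * L] and an
untouched point [O(k + sqrt n)].

For the computability of [f], one does not run the adversary: on [n] points it
only uses integer metrics bounded by a computable function of [n], so one
enumerates all of these, runs the algorithm on each, and lets [f n] be about the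
square root of [n / k], where [k] is a number of steps after which all the runs
have stopped. *)

(** * Recursive functions *)

(** Arguments come as one list, so that the index of a recursion, sum or bounded quantifier is
    simply consed in front of the parameters. *)
Definition recursive (k : nat) (F : seq nat -> nat) : Prop :=
  exists e, forall v, size v = k -> rec_eval e v (F v).

Lemma recursive_ext k F G :
  (forall v, size v = k -> F v = G v) -> recursive k F -> recursive k G.
Proof. by move=> FG [e eF]; exists e => v kv; rewrite -FG //; exact: eF. Qed.

Definition recursives (k : nat) (Fs : seq (seq nat -> nat)) : Prop :=
  exists es, forall v, size v = k -> rec_evals es v [seq F v | F <- Fs].

Lemma recursives_nil k : recursives k [::].
Proof. by exists [::] => v _; exact: evals_nil. Qed.

Lemma recursives_cons k F Fs :
  recursive k F -> recursives k Fs -> recursives k (F :: Fs).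
Proof.
move=> [e eF] [es esF]; exists (e :: es) => v kv.
by apply: evals_cons; [exact: eF|exact: esF].
Qed.

Lemma recursive_proj k i : recursive k (fun v => nth 0 v i).
Proof. by exists (RProj i) => v _; exact: eval_proj. Qed.

Lemma recursive_comp k F Gs : recursive (size Gs) F -> recursives k Gs ->
  recursive k (fun v => F [seq G v | G <- Gs]).
Proof.
move=> [e eF] [es esG]; exists (RComp e es) => v kv.
by apply: (eval_comp (esG v kv)); apply: eF; rewrite size_map.
Qed.

Lemma rec_evals_proj v i :
  rec_evals [seq RProj j | j <- iota i (size v - i)] v (drop i v).
Proof.
have [m] := ubnP (size v - i); elim: m i => // m IHm i lt_m.
have [le_vi|lt_iv] := leqP (size v) i.
  by rewrite drop_oversize // (eqP (le_vi : size v - i == 0)); exact: evals_nil.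
rewrite (drop_nth 0) // (_ : size v - i = (size v - i.+1).+1); last by lia.
apply: evals_cons; first exact: eval_proj.
by apply: IHm; lia.
Qed.

Lemma recursive_rec k N F G :
  recursive k N -> recursive k F -> recursive k.+2 G ->
  recursive k (fun v => nat_rect (fun=> nat) (F v)
                          (fun i z => G [:: i, z & v]) (N v)).
Proof.
move=> [eN HN] [eF HF] [eG HG].
exists (RComp (RPrim eF eG) (eN :: [seq RProj j | j <- iota 0 k])) => v kv.
apply: (@eval_comp _ _ _ (N v :: v)).
  apply: evals_cons; first exact: HN.
  by have := rec_evals_proj v 0; rewrite drop0 subn0 kv.
elim: (N v) => [|n IHn] /=; first by apply: eval_prim0; exact: HF.
by apply: (eval_primS IHn); apply: HG; rewrite /= kv.
Qed.

Lemma recursive0 k : recursive k (fun=> 0).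
Proof. by exists RZero => v _; exact: eval_zero. Qed.

Lemma recursiveS k F : recursive k F -> recursive k (fun v => (F v).+1).
Proof.
move=> [e eF]; exists (RComp RSucc [:: e]) => v kv.
apply: (@eval_comp _ _ _ [:: F v]); last exact: eval_succ.
by apply: evals_cons; [exact: eF|exact: evals_nil].
Qed.

Lemma recursive_const k c : recursive k (fun=> c).
Proof. by elim: c => [|c IHc]; [exact: recursive0|exact: recursiveS IHc]. Qed.

Lemma recursive_app1 k (F : nat -> nat) G :
  recursive 1 (fun v => F (nth 0 v 0)) -> recursive k G ->
  recursive k (fun v => F (G v)).
Proof.
move=> rF rG; apply: (@recursive_comp _ _ [:: G] rF).
by apply: recursives_cons => //; exact: recursives_nil.
Qed.

Lemma recursive_app2 k (F : nat -> nat -> nat) G1 G2 :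
  recursive 2 (fun v => F (nth 0 v 0) (nth 0 v 1)) ->
  recursive k G1 -> recursive k G2 ->
  recursive k (fun v => F (G1 v) (G2 v)).
Proof.
move=> rF r1 r2; apply: (@recursive_comp _ _ [:: G1; G2] rF).
by do 2!apply: recursives_cons => //; exact: recursives_nil.
Qed.

Lemma recursive_app3 k (F : nat -> nat -> nat -> nat) G1 G2 G3 :
  recursive 3 (fun v => F (nth 0 v 0) (nth 0 v 1) (nth 0 v 2)) ->
  recursive k G1 -> recursive k G2 -> recursive k G3 ->
  recursive k (fun v => F (G1 v) (G2 v) (G3 v)).
Proof.
move=> rF r1 r2 r3; apply: (@recursive_comp _ _ [:: G1; G2; G3] rF).
by do 3!apply: recursives_cons => //; exact: recursives_nil.
Qed.

Lemma recursive_add k F G : recursive k F -> recursive k G ->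
  recursive k (fun v => F v + G v).
Proof.
move=> rF rG; apply: (recursive_app2 (F := addn) _ rF rG).
apply: recursive_ext (recursive_rec (recursive_proj 2 0) (recursive_proj 2 1)
  (recursiveS (recursive_proj 4 1))) => v _ /=.
by elim: (nth 0 v 0) => //= n ->.
Qed.

Lemma recursive_mul k F G : recursive k F -> recursive k G ->
  recursive k (fun v => F v * G v).
Proof.
move=> rF rG; apply: (recursive_app2 (F := muln) _ rF rG).
apply: recursive_ext (recursive_rec (recursive_proj 2 0) (recursive0 2)
  (recursive_add (recursive_proj 4 3) (recursive_proj 4 1))) => v _ /=.
by elim: (nth 0 v 0) => //= n ->; rewrite mulSn.
Qed.

Lemma recursive_exp k F G : recursive k F -> recursive k G ->
  recursive k (fun v => F v ^ G v).
Proof.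
move=> rF rG; apply: (recursive_app2 (F := expn) _ rF rG).
apply: recursive_ext (recursive_rec (recursive_proj 2 1) (recursive_const 2 1)
  (recursive_mul (recursive_proj 4 2) (recursive_proj 4 1))) => v _ /=.
by elim: (nth 0 v 1) => //= n ->; rewrite expnS.
Qed.

Lemma recursive_pred k F : recursive k F -> recursive k (fun v => (F v).-1).
Proof.
move=> rF; apply: (recursive_app1 (F := predn) _ rF).
apply: recursive_ext (recursive_rec (recursive_proj 1 0) (recursive0 1)
  (recursive_proj 3 0)) => v _ /=.
by case: (nth 0 v 0).
Qed.

Lemma recursive_sub k F G : recursive k F -> recursive k G ->
  recursive k (fun v => F v - G v).
Proof.
move=> rF rG; apply: (recursive_app2 (F := subn) _ rF rG).
apply: recursive_ext (recursive_rec (recursive_proj 2 1) (recursive_proj 2 0)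
  (recursive_pred (recursive_proj 4 1))) => v _ /=.
by elim: (nth 0 v 1) => [|n /= ->]; rewrite ?subn0 // subnS.
Qed.

Definition recursiveb (k : nat) (P : seq nat -> bool) : Prop :=
  recursive k (fun v => P v : nat).

Lemma recursiveb_neg k P : recursiveb k P -> recursiveb k (fun v => ~~ P v).
Proof.
move=> rP; apply: recursive_ext (recursive_sub (recursive_const k 1) rP) => v _.
by case: (P v).
Qed.

Lemma recursiveb_and k P Q : recursiveb k P -> recursiveb k Q ->
  recursiveb k (fun v => P v && Q v).
Proof.
move=> rP rQ; apply: recursive_ext (recursive_mul rP rQ) => v _.
by case: (P v); case: (Q v).
Qed.

Lemma recursiveb_eq0 k F : recursive k F -> recursiveb k (fun v => F v == 0).
Proof.
move=> rF; apply: recursive_ext (recursive_sub (recursive_const k 1) rF) => v _.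
by case: (F v).
Qed.

Lemma recursiveb_leq k F G : recursive k F -> recursive k G ->
  recursiveb k (fun v => F v <= G v).
Proof. by move=> rF rG; exact: recursiveb_eq0 (recursive_sub rF rG). Qed.

Lemma recursiveb_eq k F G : recursive k F -> recursive k G ->
  recursiveb k (fun v => F v == G v).
Proof.
move=> rF rG; apply: recursive_ext (recursiveb_and (recursiveb_leq rF rG)
  (recursiveb_leq rG rF)) => v _.
by rewrite eqn_leq.
Qed.

Lemma recursive_if k P F G : recursiveb k P -> recursive k F -> recursive k G ->
  recursive k (fun v => if P v then F v else G v).
Proof.
move=> rP rF rG; apply: recursive_ext (recursive_add (recursive_mul rP rF)
  (recursive_mul (recursiveb_neg rP) rG)) => v _.
by case: (P v); rewrite ?mul1n ?addn0.
Qed.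

Lemma recursive_sum k N F : recursive k N -> recursive k.+1 F ->
  recursive k (fun v => \sum_(i < N v) F (nat_of_ord i :: v)).
Proof.
move=> rN rF.
(* These projections skip the accumulator: they send [[:: i, z & v]] to [i :: v], the list that [F]
   expects. *)
have [es esP] : recursives k.+2
    ((fun v => nth 0 v 0) :: [seq (fun v => nth 0 v j.+2) | j <- iota 0 k]).
  apply: recursives_cons; first exact: recursive_proj.
  elim: (iota 0 k) => [|j s IHs]; first exact: recursives_nil.
  by apply: recursives_cons IHs; exact: recursive_proj.
have rF2 : recursive k.+2 (fun v => F (nth 0 v 0 :: drop 2 v)).
  have [e eF] := rF; exists (RComp e es) => v kv.
  apply: (eval_comp (esP v kv)); rewrite /= -map_comp.
  rewrite (_ : [seq _ | j <- iota 0 k] = drop 2 v).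
    by apply: eF; rewrite /= size_drop kv subn2.
  apply: (@eq_from_nth _ 0); first by rewrite size_map size_iota size_drop kv subn2.
  move=> i; rewrite size_map size_iota => ik.
  by rewrite (nth_map 0) ?size_iota //= nth_iota // nth_drop add2n.
apply: recursive_ext (recursive_rec rN (recursive0 k)
  (recursive_add rF2 (recursive_proj _ 1))) => v _ /=.
elim: (N v) => [|n IHn] /=; first by rewrite big_ord0.
by rewrite IHn big_ord_recr /= drop0 addnC.
Qed.

Lemma recursiveb_all k N P : recursive k N -> recursiveb k.+1 P ->
  recursiveb k (fun v => all (fun i => P (i :: v)) (iota 0 (N v))).
Proof.
move=> rN rP.
apply: recursive_ext (recursiveb_eq0 (recursive_sum rN (recursiveb_neg rP))) => v _.
congr nat_of_bool; rewrite sum_nat_eq0; apply/forallP/allP => [allP i|allP i].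
  rewrite mem_iota add0n => /andP[_ iN].
  by have /= := allP (Ordinal iN); case: (P _).
by rewrite /= allP // mem_iota /= ltn_ord.
Qed.

Lemma sum_ltn m n : n <= m -> \sum_(i < m) (i < n) = n.
Proof.
elim: m => [|m IHm]; first by rewrite leqn0 big_ord0 => /eqP.
rewrite leq_eqVlt big_ord_recr /= => /predU1P[->|]; last first.
  by rewrite ltnS => le_nm; rewrite IHm // ltnNge le_nm addn0.
rewrite leqnn addn1 (eq_bigr (fun=> 1)) ?sum1_card ?card_ord // => i _.
by rewrite ltnS ltnW.
Qed.

(** The quotient counts the positive multiples of [d] up to [m]; this makes division a bounded sum,
    hence recursive. *)
Lemma sum_leq_div m d : 0 < d -> \sum_(i < m) (i.+1 * d <= m) = m %/ d.
Proof.
by move=> d_gt0; under eq_bigr do rewrite -leq_divRL //; rewrite sum_ltn ?leq_div.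
Qed.

Lemma recursive_div k F G : recursive k F -> recursive k G ->
  (forall v, size v = k -> 0 < G v) -> recursive k (fun v => F v %/ G v).
Proof.
move=> rF rG G_gt0.
have r2 : recursive 2 (fun v =>
    \sum_(i < nth 0 v 0) (i.+1 * nth 0 v 1 <= nth 0 v 0)).
  apply: (recursive_sum (F := fun u => (nth 0 u 0).+1 * nth 0 u 2 <= nth 0 u 1)).
    exact: recursive_proj.
  apply: recursiveb_leq (recursive_proj _ _).
  by apply: recursive_mul (recursive_proj _ _); apply/recursiveS/recursive_proj.
apply: recursive_ext (recursive_app2 (F := fun a b => \sum_(i < a) (i.+1 * b <= a))
  r2 rF rG) => v kv.
by rewrite sum_leq_div ?G_gt0.
Qed.

Lemma recursive_mod k F G : recursive k F -> recursive k G ->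
  (forall v, size v = k -> 0 < G v) -> recursive k (fun v => F v %% G v).
Proof.
move=> rF rG G_gt0.
apply: recursive_ext (recursive_sub rF (recursive_mul (recursive_div rF rG G_gt0)
  rG)) => v _.
by rewrite {1}(divn_eq (F v) (G v)) addKn.
Qed.

Ltac rec_arith := repeat lazymatch goal with
  | |- recursive ?k (fun v => nat_of_bool (@?P v)) => change (recursiveb k P)
  | |- recursiveb _ (fun v => @?P v && @?Q v) => apply: (@recursiveb_and _ P Q)
  | |- recursiveb _ (fun v => ~~ @?P v) => apply: (@recursiveb_neg _ P)
  | |- recursiveb _ (fun v => @?F v <= @?G v) => apply: (@recursiveb_leq _ F G)
  | |- recursiveb _ (fun v => @?F v == @?G v) => apply: (@recursiveb_eq _ F G)
  | |- recursive _ (fun v => nth 0 v _) => exact: recursive_proj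
  | |- recursive _ (fun v => (@?F v).+1) => apply: (@recursiveS _ F)
  | |- recursive _ (fun v => (@?F v).-1) => apply: (@recursive_pred _ F)
  | |- recursive _ (fun v => @?F v + @?G v) => apply: (@recursive_add _ F G)
  | |- recursive _ (fun v => @?F v * @?G v) => apply: (@recursive_mul _ F G)
  | |- recursive _ (fun v => @?F v ^ @?G v) => apply: (@recursive_exp _ F G)
  | |- recursive _ (fun v => @?F v - @?G v) => apply: (@recursive_sub _ F G)
  | |- recursive _ (fun _ => ?c) => exact: recursive_const
  end.

(** * The growth sequence *)

(** The recurrence, made explicit in [growthE], is that of a ball bound: 1 for the centre, and for
    each radius [j] at most [growth j] edges, each leading to a ball of radius at most [r - 1 - j].
    The list is carried along because all earlier values are needed. *)
Fixpoint growth_seq (n : nat) : seq nat :=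
  if n is m.+1 then
    let g := growth_seq m in
    rcons g (1 + \sum_(j < m) nth 0 g j * nth 0 g (m.-1 - j))
  else [::].

Definition growth (r : nat) : nat := nth 0 (growth_seq r.+1) r.

Lemma size_growth_seq n : size (growth_seq n) = n.
Proof. by elim: n => //= n IHn; rewrite size_rcons IHn. Qed.

Lemma nth_growth_seq n r : r < n -> nth 0 (growth_seq n) r = growth r.
Proof.
elim: n => // n IHn; rewrite ltnS leq_eqVlt => /predU1P[-> //|lt_rn].
by rewrite /= nth_rcons size_growth_seq lt_rn IHn.
Qed.

Lemma growthE r :
  growth r = 1 + \sum_(j < r) growth j * growth (r.-1 - j).
Proof.
rewrite {1}/growth /= nth_rcons size_growth_seq ltnn eqxx; congr (1 + _).
by apply: eq_bigr => j _; rewrite !nth_growth_seq //; have := ltn_ord j; lia.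
Qed.

Lemma growth_gt0 r : 0 < growth r.
Proof. by rewrite growthE. Qed.

Lemma leq_growthS n : growth n <= growth n.+1.
Proof.
elim/ltn_ind: n => n IHn.
rewrite growthE (growthE n.+1) leq_add2l big_ord_recr /=.
apply: leq_trans (leq_addr _ _); apply: leq_sum => j _.
have ltjn := ltn_ord j.
by rewrite leq_mul2l (_ : n - j = (n.-1 - j).+1) ?IHn ?orbT //; lia.
Qed.

Lemma leq_growth m n : m <= n -> growth m <= growth n.
Proof.
move=> /subnK <-; elim: (n - m) => // k IHk.
by rewrite addSn (leq_trans IHk) ?leq_growthS.
Qed.

(** Cost of lifting one vertex to height [n]: the heights [n - s] forced at distance [s] add up to
    the sizes of the balls of radii below [n]. *)
Definition volume (n : nat) : nat := \sum_(r < n) growth r.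

Lemma volumeS n : volume n.+1 = volume n + growth n.
Proof. by rewrite /volume big_ord_recr. Qed.

Lemma volume_ge n : n <= volume n.
Proof. by elim: n => // n IHn; rewrite volumeS; have := growth_gt0 n; lia. Qed.

Section GrowthBound.
Local Open Scope ring_scope.

(* Read off from the generating function: the truncations P_n at x = 1/8 satisfy
   P_{n+1} <= 1/(1-x) + x P_n^2, an inequality that preserves the bound 2. *)
Lemma growth_gf_le (F : realFieldType) (x : F) (n : nat) : x = 1 / 8 ->
  \sum_(r < n) (growth r)%:R * x ^+ r <= 2.
Proof.
move=> xE; have x0 : 0 <= x by lra.
elim: n => [|n IHn]; first by rewrite big_ord0.
set P := \sum_(r < n) _ in IHn.
have P0 : 0 <= P by apply: sumr_ge0 => i _; rewrite mulr_ge0 ?exprn_ge0.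
have geo m : \sum_(r < m) x ^+ r <= 8 / 7.
  suff -> : \sum_(r < m) x ^+ r = 8 / 7 - 8 / 7 * x ^+ m.
    by have := exprn_ge0 m x0; lra.
  elim: m => [|m IHm]; first by rewrite big_ord0 expr0; lra.
  by rewrite big_ord_recr /= IHm exprS; move: (x ^+ m) => y; rewrite xE; lra.
have conv : \sum_(r < n.+1) (\sum_(j < r) (growth j * growth (r.-1 - j))%:R) * x ^+ r
    <= x * P ^+ 2.
  rewrite big_ord_recl big_ord0 mul0r add0r.
  rewrite expr2 {1}/P mulr_suml mulr_sumr.
  have -> : \sum_(i < n) (\sum_(j < bump 0 i)
      (growth j * growth ((bump 0 i).-1 - j))%:R) * x ^+ bump 0 i =
    \sum_(i < n) \sum_(j < n | (j <= i)%N) (growth j * growth (i - j))%:R * x ^+ i.+1.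
    apply: eq_bigr => i _; rewrite mulr_suml.
    by rewrite (big_ord_widen n (fun j => (growth j * growth (i - j))%:R * x ^+ i.+1)) //.
  rewrite (exchange_big_dep xpredT) //=; apply: ler_sum => j _.
  rewrite mulr_sumr mulr_sumr.
  rewrite -(big_mkord (fun i => (j <= i)%N)
     (fun i => (growth j * growth (i - j))%:R * x ^+ i.+1)).
  rewrite -(big_mkord xpredT (fun i =>
     x * ((growth j)%:R * x ^+ j * ((growth i)%:R * x ^+ i)))).
  (* For fixed [j], substitute [i - j] for [i]; what remains of the row of the square is nonnegative
     and is dropped. *)
  have lt_jn := ltn_ord j.
  rewrite (big_cat_nat (n := j)) //= ?(ltnW lt_jn) //.
  rewrite big_nat_cond big_pred0 ?add0r; last first.
    by move=> i; apply/negbTE; lia.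
  rewrite -{1}(add0n (j : nat)) big_addn.
  rewrite [leRHS](big_cat_nat (n := (n - j)%N)) //= ?leq_subr //.
  rewrite -[leLHS]addr0; apply: lerD.
    rewrite big_mkcond /=; apply: ler_sum => i _.
    rewrite leq_addl addnK natrM -addSn exprD exprS.
    rewrite (_ : _ * (x * _ * _) =
      x * ((growth j)%:R * x ^+ j * ((growth i)%:R * x ^+ i))) //.
    by ring.
  by apply: sumr_ge0 => i _; rewrite !mulr_ge0 ?exprn_ge0.
have -> : \sum_(r < n.+1) (growth r)%:R * x ^+ r =
    \sum_(r < n.+1) x ^+ r
    + \sum_(r < n.+1) (\sum_(j < r) (growth j * growth (r.-1 - j))%:R) * x ^+ r.
  rewrite -big_split /=; apply: eq_bigr => r _.
  by rewrite growthE natrD natr_sum mulrDl mul1r.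
have := geo n.+1; have : x * P ^+ 2 <= 1 / 2 by rewrite xE; nra.
lra.
Qed.

Lemma growth_le r : (growth r <= 2 * 8 ^ r)%N.
Proof.
have := @growth_gf_le rat _ r.+1 erefl; rewrite big_ord_recr /= => le2.
have : (growth r)%:R * (1 / 8) ^+ r <= 2 :> rat.
  apply: le_trans le2; rewrite lerDr.
  by apply: sumr_ge0 => i _; rewrite mulr_ge0 ?exprn_ge0.
rewrite expr_div_n expr1n mulrA mulr1 ler_pdivrMr ?exprn_gt0 //.
by rewrite -natrX -natrM ler_nat.
Qed.

End GrowthBound.

Lemma volume_le n : volume n <= 8 ^ n.
Proof.
elim: n => [|n IHn]; first by rewrite /volume big_ord0.
by rewrite volumeS expnS; have := growth_le n; lia.
Qed.

(** * Heights prescribed by degrees *)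

Lemma radius_ex k : exists R, k.+1 < volume R.+1.
Proof. by exists k.+1; exact: volume_ge. Qed.

(** The largest [R] with [volume R <= k + 1]: the greatest height whose cost a vertex of degree [k]
    can be charged for. *)
Definition radius (k : nat) : nat := ex_minn (radius_ex k).

Lemma volume_radius k : volume (radius k) <= k.+1.
Proof.
rewrite /radius; case: ex_minnP => -[|R] _ minR; first by rewrite /volume big_ord0.
by rewrite leqNgt; apply/negP => /minR; rewrite ltnn.
Qed.

Lemma lt_volume_radius k : k.+1 < volume (radius k).+1.
Proof. by rewrite /radius; case: ex_minnP. Qed.

Lemma radius_gt0 k : 0 < radius k.
Proof.
rewrite lt0n; apply/eqP => r0; have := lt_volume_radius k.
by rewrite r0 volumeS /volume big_ord0 /growth /= big_ord0.
Qed.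

Lemma radius_le k : radius k <= k.+1.
Proof. by rewrite /radius; case: ex_minnP => R _; apply; exact: volume_ge. Qed.

Lemma leq_radius j k : j <= k -> radius j <= radius k.
Proof.
move=> jk; rewrite {1}/radius; case: ex_minnP => R _; apply.
by rewrite (leq_trans _ (lt_volume_radius k)) // ltnS.
Qed.

Lemma sum_leq_lt k a b : \sum_(i < k) (a <= i < b) <= b - a.
Proof.
suff: \sum_(i < k) (a <= i < b) <= minn k b - a by move=> h; apply: leq_trans h _; lia.
elim: k => [|k IHk]; first by rewrite big_ord0.
by rewrite big_ord_recr /=; move: (\sum_(i < k) _) IHk => t; lia.
Qed.

(** [radius i = j] forces [volume j - 1 <= i < volume (j + 1) - 1], an interval of length at most
    [growth j]. *)
Lemma card_radius k j : \sum_(i < k) (radius i == j) <= growth j.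
Proof.
apply: leq_trans (_ : \sum_(i < k) ((volume j).-1 <= i < (volume j.+1).-1) <= _).
  apply: leq_sum => i _; case: eqP => // <-.
  by have := volume_radius i; have := lt_volume_radius i; lia.
by apply: leq_trans (sum_leq_lt _ _ _) _; rewrite volumeS; lia.
Qed.

(** Grouping the indices by their radius turns [card_radius] into the recurrence of [growth];
    strictness leaves room for the centre of the ball. *)
Lemma sum_growth_radius k r :
  \sum_(i < k | radius i < r) growth (r.-1 - radius i) < growth r.
Proof.
rewrite growthE add1n ltnS.
have -> : \sum_(i < k | radius i < r) growth (r.-1 - radius i) =
    \sum_(i < k) \sum_(j < r | radius i == j) growth (r.-1 - j).
  rewrite big_mkcond; apply: eq_bigr => i _.
  case: ifPn => [lt_ir|ge_ir].
    by rewrite (big_pred1 (Ordinal lt_ir)).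
  rewrite big_pred0 // => j; apply/negbTE; move: ge_ir.
  by apply: contraNneq => ->.
rewrite (exchange_big_dep xpredT) //=; apply: leq_sum => j _.
rewrite sum_nat_cond_const leq_mul2r; apply/orP; right.
apply: leq_trans (card_radius k j); rewrite -sum1_card big_mkcond.
by apply: leq_sum => i _; rewrite inE; case: ifP.
Qed.

(** * Graphs and hub metrics *)

Section Graph.
Variable T : finType.
Implicit Types (G : seq (T * T * nat)) (a b c x y p : T) (e : T * T * nat).

Definition adj G a b w := ((a, b, w) \in G) || ((b, a, w) \in G).

Lemma adjC G a b w : adj G a b w = adj G b a w.
Proof. by rewrite /adj orbC. Qed.

Inductive walk G : T -> T -> nat -> Prop :=
| walk_nil a : walk G a a 0
| walk_cons a c b w r : adj G a c w -> walk G c b r -> walk G a b (w + r).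

Lemma walk_cat G a b c r s : walk G a b r -> walk G b c s -> walk G a c (r + s).
Proof.
elim=> // {}a a' b' w q aa' _ IH bc; rewrite -addnA.
by apply: walk_cons aa' _; exact: IH.
Qed.

Lemma walk_edge G a b w : adj G a b w -> walk G a b w.
Proof. by move=> ab; rewrite -[w]addn0; exact: walk_cons ab (walk_nil _ _). Qed.

Lemma walk_sym G a b r : walk G a b r -> walk G b a r.
Proof.
elim=> [c|{}a c {}b w q ac _ IH]; first exact: walk_nil.
by rewrite addnC; apply: walk_cat IH (walk_edge _); rewrite adjC.
Qed.

Lemma walk_sub G G' a b r : {subset G <= G'} -> walk G a b r -> walk G' a b r.
Proof.
move=> GG'; elim=> [c|{}a c {}b w q ac _ IH]; first exact: walk_nil.
apply: walk_cons IH; move: ac; rewrite /adj.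
by case/orP => /GG' ->; rewrite ?orbT.
Qed.

Definition subadditive_dist (d : T -> T -> nat) :=
  (forall a, d a a = 0) /\ (forall a b c, d a c <= d a b + d b c).

Lemma walk_ge G d a b r : subadditive_dist d ->
  (forall a b w, adj G a b w -> d a b <= w) -> walk G a b r -> d a b <= r.
Proof.
move=> [d0 dtri] dG; elim=> [c|{}a c {}b w q ac _ IH]; first by rewrite d0.
by rewrite (leq_trans (dtri a c b)) // leq_add // dG.
Qed.

Variable M : nat.

Lemma gdist_ex G a b : exists r, (r == M) || `[<walk G a b r>].
Proof. by exists M; rewrite eqxx. Qed.

(** The shortest walk length truncated at [M], so that distances between components are finite and
    the triangle inequality survives. *)
Definition gdist G a b : nat := ex_minn (gdist_ex G a b).

Lemma gdist_le G a b r : walk G a b r -> gdist G a b <= r.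
Proof.
by move=> wr; rewrite /gdist; case: ex_minnP => d _; apply; rewrite asboolT ?orbT.
Qed.

Lemma gdist_leM G a b : gdist G a b <= M.
Proof. by rewrite /gdist; case: ex_minnP => d _; apply; rewrite eqxx. Qed.

Lemma gdist_case G a b : gdist G a b = M \/ walk G a b (gdist G a b).
Proof.
rewrite /gdist; case: ex_minnP => d /orP[/eqP->|/asboolP wd] _; first by left.
by right.
Qed.

Lemma gdist_refl G a : gdist G a a = 0.
Proof. by apply/eqP; rewrite -leqn0; apply/gdist_le/walk_nil. Qed.

Lemma gdist_sym G a b : gdist G a b = gdist G b a.
Proof.
suff h x y : gdist G x y <= gdist G y x by apply/eqP; rewrite eqn_leq !h.
case: (gdist_case G y x) => [->|/walk_sym]; [exact: gdist_leM|exact: gdist_le].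
Qed.

Lemma gdist_tri G a b c : gdist G a c <= gdist G a b + gdist G b c.
Proof.
have le_M := gdist_leM G a c.
case: (gdist_case G a b) => [->|ab]; first exact: leq_trans (leq_addr _ _).
case: (gdist_case G b c) => [->|bc]; first exact: leq_trans (leq_addl _ _).
exact: gdist_le (walk_cat ab bc).
Qed.

Lemma gdist_sub G G' a b : {subset G <= G'} -> gdist G' a b <= gdist G a b.
Proof.
move=> GG'; case: (gdist_case G a b) => [->|/(walk_sub GG')]; first exact: gdist_leM.
exact: gdist_le.
Qed.

Lemma gdist_ge G d a b : subadditive_dist d -> (forall a b, d a b <= M) ->
  (forall a b w, adj G a b w -> d a b <= w) -> d a b <= gdist G a b.
Proof.
move=> dP dM dG; case: (gdist_case G a b) => [->//|]; exact: walk_ge.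
Qed.

(* Distances when one may also travel through a hub lying at distance [H x]
   from each point [x]. *)
Definition hub_dist (D : T -> T -> nat) (H : T -> nat) x y : nat :=
  if x == y then 0 else minn (D x y) (H x + H y).

(** Two detours contain one. In the mixed case the Lipschitz hypothesis gives [H a <= D a b + H b],
    so a direct leg is absorbed in the detour. *)
Lemma hub_dist_tri (D : T -> T -> nat) H a b c :
  (forall a b c, D a c <= D a b + D b c) -> (forall a b, D a b = D b a) ->
  (forall x y, H x <= H y + D y x) ->
  hub_dist D H a c <= hub_dist D H a b + hub_dist D H b c.
Proof.
move=> Dtri Dsym Hlip; rewrite /hub_dist.
case: (eqVneq a c) => // ac.
case: (eqVneq a b) => [<-|_]; first by rewrite (negbTE ac).
case: (eqVneq b c) => [->|_]; first by rewrite addn0.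
have := Dtri a b c; have := Hlip a b; have := Hlip c b; have := Dsym a b; lia.
Qed.

(** The least function above [eta] that is 1-Lipschitz for [gdist]; by truncated subtraction, far
    vertices contribute 0. *)
Definition height G (eta : T -> nat) x : nat := \max_a (eta a - gdist G a x).

Lemma height_ge G eta x : eta x <= height G eta x.
Proof.
have := @leq_bigmax _ (fun a => eta a - gdist G a x) x.
by rewrite gdist_refl subn0.
Qed.

Lemma height_lip G eta x y : height G eta x <= height G eta y + gdist G y x.
Proof.
apply/bigmax_leqP => a _.
have := @leq_bigmax _ (fun a => eta a - gdist G a y) a.
by rewrite -/(height G eta y); have := gdist_tri G a x y; rewrite (gdist_sym G x y); lia.
Qed.

(** * Degrees and sizes of balls *)

Definition incident a e := (e.1.1 == a) || (e.1.2 == a).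
Definition other a e := if e.1.1 == a then e.1.2 else e.1.1.
Definition deg G a := count (incident a) G.

Lemma sum_deg G : \sum_a deg G a <= (size G).*2.
Proof.
elim: G => [|e G IHG]; first by rewrite big1.
rewrite /= big_split /= doubleS -addn2 addnC leq_add //.
apply: leq_trans (_ : \sum_a ((a == e.1.1) + (a == e.1.2)) <= _).
  by apply: leq_sum => a _; rewrite /incident ![_ == a]eq_sym; do 2!case: eqP.
have sum1 x : \sum_a (a == x) = 1.
  by rewrite (bigD1 x) //= eqxx big1 // => a /negbTE->.
by rewrite big_split /= !sum1.
Qed.

Lemma deg_eq0_walk G a b r : deg G a = 0 -> walk G a b r -> a = b.
Proof.
move=> /eqP; rewrite -leqn0 leqNgt -has_count => noG wab.
case: wab noG => // {}a c {}b w q ac _ /negP[]; apply/hasP.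
by case/orP: ac => acG; [exists (a, c, w)|exists (c, a, w)];
  rewrite // /incident eqxx ?orbT.
Qed.

Lemma gdist_isolated G a b : deg G a = 0 -> a <> b -> gdist G a b = M.
Proof. by move=> a0 ab; case: (gdist_case G a b) => // /(deg_eq0_walk a0). Qed.

(* Edges are listed from the last inserted one: each is heavier than the radii of
   its endpoints before its insertion. *)
Fixpoint graded G : bool :=
  if G is e :: G' then
    [&& radius (deg G' e.1.1) < e.2, radius (deg G' e.1.2) < e.2 & graded G']
  else true.

Lemma graded_gt0 G e : graded G -> e \in G -> 0 < e.2.
Proof.
elim: G => //= e' G IHG /and3P[w1 _ grG]; rewrite inE => /predU1P[->|/IHG]; last exact.
exact: leq_ltn_trans w1.
Qed.

Lemma walk0_eq G a b : graded G -> walk G a b 0 -> a = b.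
Proof.
move=> grG; suff h r : walk G a b r -> r = 0 -> a = b by move/h; apply.
case=> // {}a c {}b w q ac _ /eqP; rewrite addn_eq0 => /andP[/eqP w0 _].
by case/orP: ac => /(graded_gt0 grG); rewrite w0.
Qed.

Definition gball G a r : {set T} := [set x | `[<exists2 s, s <= r & walk G a x s>]].

Lemma gballP G a r x :
  reflect (exists2 s, s <= r & walk G a x s) (x \in gball G a r).
Proof. by rewrite finset.in_set; exact: asboolP. Qed.

Lemma leq_card_bigcup_seq (I : Type) (s : seq I) (P : pred I) (B : I -> {set T}) :
  #|\bigcup_(i <- s | P i) B i| <= \sum_(i <- s | P i) #|B i|.
Proof.
elim/big_rec2: _ => [|i n A _ le_An]; first by rewrite cards0.
by rewrite (leq_trans (leq_card_setU _ _)) // leq_add2l.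
Qed.

Lemma sub_bigcup_seq (I : eqType) (s : seq I) (P : pred I) (B : I -> {set T}) i x :
  i \in s -> P i -> x \in B i -> x \in \bigcup_(j <- s | P j) B j.
Proof.
elim: s => // j s IHs; rewrite inE big_cons => /predU1P[<- ->|js Pi xB].
  by rewrite inE => ->.
by case: ifP => _; rewrite ?inE IHs ?orbT.
Qed.

(** Induction in the order of insertion: an edge inserted when [a] has degree [i] is heavier than
    [radius i], so it leaves a radius of at most [r - 1 - radius i]. *)
Lemma sum_graded_growth G a r : graded G ->
  \sum_(e <- G | incident a e && (e.2 <= r)) growth (r - e.2) <=
  \sum_(i < deg G a | radius i < r) growth (r.-1 - radius i).
Proof.
elim: G => [|e G IHG] /=; first by rewrite big_nil.
case/and3P => w1 w2 /IHG {}IHG; rewrite big_cons.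
have [ae|_] := boolP (incident a e); last by rewrite /= add0n.
have lt_e : radius (deg G a) < e.2 by case/orP: ae => /eqP <-.
rewrite /= add1n [leqRHS]big_mkcond big_ord_recr /= -big_mkcond /=.
case: ifPn => [le_er|_]; last by rewrite (leq_trans IHG) ?leq_addr.
rewrite (leq_trans lt_e) // addnC leq_add // leq_growth //; lia.
Qed.

(** Strong induction on [r]: a nonempty walk starts with an edge of positive weight, so the ball
    consists of [a] and of smaller balls around its neighbours, whose sizes sum to less than
    [growth r]. *)
Lemma card_gball G a r : graded G -> #|gball G a r| <= growth r.
Proof.
move=> grG; elim/ltn_ind: r a => r IHr a.
apply: leq_trans (_ : #|a |: \bigcup_(e <- G | incident a e && (e.2 <= r))
  gball G (other a e) (r - e.2)| <= _).
  apply/subset_leq_card/fintype.subsetP => x /gballP[s le_sr]; rewrite finset.in_setU1.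
  move=> wax; case: wax le_sr grG IHr => [b|{}a c {}x w q ac cx] le_sr grG IHr.
    by rewrite eqxx.
  have cxB : x \in gball G c (r - w).
    by apply/gballP; exists q => //; lia.
  apply/orP; right; have le_wr : w <= r by lia.
  case/orP: ac => [acG|caG].
    by apply: (sub_bigcup_seq acG); rewrite /incident /other ?eqxx.
  apply: (sub_bigcup_seq caG); first by rewrite /incident eqxx orbT.
  by rewrite /other /=; case: eqP => [<-|].
rewrite (leq_trans (leq_card_setU _ _)) // cards1 add1n.
apply: leq_ltn_trans (leq_card_bigcup_seq _ _ _) _.
apply: leq_ltn_trans (sum_growth_radius (deg G a) r).
apply: leq_trans (sum_graded_growth a r grG).
rewrite big_seq_cond [leqRHS]big_seq_cond; apply: leq_sum => e /andP[eG /andP[_ le_er]].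
by apply: IHr; have := graded_gt0 grG eG; lia.
Qed.

(** Bound the maximum by the sum over [a], then write [eta a - gdist G a x] as the number of radii
    [r < eta a] whose ball contains [x]. By [eta a <= M], unreachable points contribute nothing. *)
Lemma sum_height G eta : graded G -> (forall a, eta a <= M) ->
  \sum_x height G eta x <= \sum_a volume (eta a).
Proof.
move=> grG etaM.
apply: leq_trans (_ : \sum_x \sum_a (eta a - gdist G a x) <= _).
  by apply: leq_sum => x _; apply/bigmax_leqP => a _; rewrite (bigD1 a) //= leq_addr.
rewrite exchange_big /=; apply: leq_sum => a _.
apply: leq_trans (_ : \sum_x \sum_(r < eta a) (x \in gball G a r) <= _).
  apply: leq_sum => x _; have := etaM a.
  case: (gdist_case G a x) => [->|]; first by lia.
  move: (gdist G a x) => d wd _.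
  apply: leq_trans (_ : \sum_(r < eta a) (d <= r) <= _).
    elim: (eta a) => [|k IHk]; first by rewrite big_ord0 sub0n.
    by rewrite big_ord_recr /=; move: (\sum_(i < k) _) IHk => t; lia.
  apply: leq_sum => r _; case: (leqP d r) => // le_dr.
  by rewrite lt0b; apply/gballP; exists d.
rewrite exchange_big /=; apply: leq_sum => r _.
apply: leq_trans (card_gball a r grG); rewrite -sum1_card [leqRHS]big_mkcond.
by apply: leq_sum => x _; case: ifP.
Qed.

(** * One move of the adversary *)

Definition play_height G := height G (fun a => radius (deg G a)).

Definition play_dist G := hub_dist (gdist G) (play_height G).

Definition play_next G x y :=
  if (x != y) && (play_height G x + play_height G y < gdist G x y)
  then (x, y, play_height G x + play_height G y) :: G else G.

(** What keeps an answer valid forever: it is a distance in the graph, and the detour through the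
    hub is no shorter. Heights only grow, so the detour stays no shorter. *)
Definition answered G (q : T * T * nat) := let: (x, y, w) := q in
  [/\ walk G x y w, gdist G x y = w & w <= play_height G x + play_height G y].

Lemma play_next_sub G x y : {subset G <= play_next G x y}.
Proof.
by rewrite /play_next; case: ifP => _ e; rewrite ?inE // => ->; rewrite orbT.
Qed.

Lemma size_play_next G x y : size (play_next G x y) <= (size G).+1.
Proof. by rewrite /play_next; case: ifP. Qed.

Lemma play_height_gt0 G x : 0 < play_height G x.
Proof. exact: leq_trans (radius_gt0 _) (height_ge _ _ _). Qed.

Lemma graded_play_next G x y : graded G -> graded (play_next G x y).
Proof.
rewrite /play_next; case: ifP => //= _ ->; rewrite andbT.
have := height_ge G (fun a => radius (deg G a)) x.
have := height_ge G (fun a => radius (deg G a)) y.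
rewrite -/(play_height G) => hx hy.
by have := play_height_gt0 G x; have := play_height_gt0 G y; lia.
Qed.

Lemma leq_deg_play_next G x y a : deg G a <= deg (play_next G x y) a.
Proof. by rewrite /play_next /deg; case: ifP => //= _; rewrite leq_addl. Qed.

Lemma leq_play_height_next G x y a :
  play_height G a <= play_height (play_next G x y) a.
Proof.
apply/bigmax_leqP => b _.
have := @leq_bigmax _ (fun b => radius (deg (play_next G x y) b)
  - gdist (play_next G x y) b a) b.
apply: leq_trans; have := leq_radius (leq_deg_play_next G x y b).
by have := gdist_sub b a (@play_next_sub G x y); lia.
Qed.

Lemma play_dist_subadditive G : subadditive_dist (play_dist G).
Proof.
split=> [a|a b c]; first by rewrite /play_dist /hub_dist eqxx.
apply: hub_dist_tri; [exact: gdist_tri|exact: gdist_sym|exact: height_lip].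
Qed.

Lemma play_dist_sym G a b : play_dist G a b = play_dist G b a.
Proof. by rewrite /play_dist /hub_dist eq_sym gdist_sym addnC. Qed.

Lemma play_dist_le G a b : play_dist G a b <= gdist G a b.
Proof. by rewrite /play_dist /hub_dist; case: ifP => // _; exact: geq_minl. Qed.

(** The inserted edge is as long as the detour between its endpoints, hence no shorter than their
    [play_dist]; by subadditivity no walk through it beats [play_dist]. *)
Lemma play_dist_le_gdist_next G x y a b :
  play_dist G a b <= gdist (play_next G x y) a b.
Proof.
apply: gdist_ge (play_dist_subadditive G) _ _ => {a b}[a b|a b w].
  exact: leq_trans (play_dist_le G a b) (gdist_leM _ _ _).
have old c d : adj G c d w -> play_dist G c d <= w.
  by move=> /walk_edge/gdist_le; apply: leq_trans (play_dist_le _ _ _).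
rewrite /play_next; case: ifP => [/andP[xy _]|_]; last exact: old.
have new : play_dist G x y <= play_height G x + play_height G y.
  by rewrite /play_dist /hub_dist (negbTE xy) geq_minr.
rewrite /adj !inE => /orP[]/orP[/eqP[-> -> ->]//|abG].
- by apply: old; rewrite /adj abG.
- by rewrite play_dist_sym.
- by apply: old; rewrite /adj abG orbT.
Qed.

Lemma play_height_le G x : play_height G x <= (size G).+1.
Proof.
apply/bigmax_leqP => a _; apply: leq_trans (leq_subr _ _) _.
by apply: leq_trans (radius_le _) _; rewrite ltnS count_size.
Qed.

Lemma answered_old G x y q : answered G q -> answered (play_next G x y) q.
Proof.
case: q => [[a b] w] [wab Dab le_w]; split.
- exact: walk_sub (@play_next_sub G x y) wab.
- apply/eqP; rewrite eqn_leq -{1}Dab gdist_sub /=; last exact: play_next_sub.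
  (* As the detour is no shorter than [w], [play_dist G a b] equals [w] and bounds the new distance
     from below. *)
  apply: leq_trans (play_dist_le_gdist_next G x y a b).
  rewrite /play_dist /hub_dist; case: eqP => [ab|_]; last by rewrite leq_min Dab leqnn.
  by rewrite -Dab ab gdist_refl.
- by apply: leq_trans le_w _; rewrite leq_add ?leq_play_height_next.
Qed.

Lemma answered_new G x y : ((size G).+1).*2 < M ->
  answered (play_next G x y) (x, y, play_dist G x y).
Proof.
move=> GM.
have wxy : walk (play_next G x y) x y (play_dist G x y).
  rewrite /play_dist /play_next /hub_dist; case: eqP => [->|_]; first exact: walk_nil.
  case: ltnP => /= [lt_HD|le_DH].
    by apply: walk_edge; rewrite /adj inE eqxx.
  (* Heights are at most [size G + 1], so detours are shorter than [M]: without a walk, the edge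
     would have been inserted. *)
  case: (gdist_case G x y) => // DM.
  by have := play_height_le G x; have := play_height_le G y; lia.
split=> //.
  by apply/eqP; rewrite eqn_leq gdist_le //= play_dist_le_gdist_next.
apply: leq_trans (leq_add (leq_play_height_next _ x y _) (leq_play_height_next _ x y _)).
by rewrite /play_dist /hub_dist; case: ifP => // _; exact: geq_minr.
Qed.

End Graph.

Definition isolated (T : finType) (G : seq (T * T * nat)) (p : T) : {set T} :=
  [set x | (deg G x == 0) && (x != p)].

Lemma card_isolated (T : finType) (G : seq (T * T * nat)) (p : T) :
  #|T| <= #|isolated G p| + 1 + (size G).*2.
Proof.
have := sum_deg G.
have -> : #|isolated G p| = \sum_x (x \in isolated G p).
  by rewrite -sum1_card big_mkcond; apply: eq_bigr => x _; case: ifP.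
have <- : \sum_x (x == p) = 1.
  by rewrite (bigD1 p) //= eqxx big1 // => a /negbTE->.
move=> le_deg; apply: leq_trans (leq_add (leqnn _) le_deg); rewrite -!big_split /=.
rewrite -sum1_card; apply: leq_sum => x _; rewrite inE.
by case: eqP; case: eqP => //=; lia.
Qed.

(** * The metric chosen once the output is known *)

Section FinalMetric.
Variables (T : finType) (M scale : nat) (G : seq (T * T * nat)) (p : T) (L : nat).
Hypotheses (grG : graded G) (GM : (size G).+1 <= M) (LM : L <= M) (scale_gt0 : 0 < scale).
Implicit Types (a b c x y v : T).

Let D := gdist M G.

(* Only touched points and [p] are lifted, so that the hub is next to all the
   others. *)
Definition final_eta a : nat :=
  maxn (if a == p then L else 0) (if 0 < deg G a then radius (deg G a) else 0).

Let H := height M G final_eta.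

(** The added 1 separates points of height 0 from the hub. With [scale] equal to the number of
    points, these units cost only [2 * scale] in total. *)
Definition final_dist x y : nat :=
  hub_dist (fun x y => scale * D x y) (fun x => (scale * H x).+1) x y.

Lemma final_eta_le a : final_eta a <= M.
Proof.
have : radius (deg G a) <= M.
  by rewrite (leq_trans (radius_le _)) // (leq_trans _ GM) // ltnS count_size.
by rewrite /final_eta; case: ifP => _; case: ifP => _; lia.
Qed.

Lemma final_dist_refl x : final_dist x x = 0.
Proof. by rewrite /final_dist /hub_dist eqxx. Qed.

Lemma final_dist_sym x y : final_dist x y = final_dist y x.
Proof. by rewrite /final_dist /hub_dist eq_sym /D gdist_sym addnC. Qed.

Lemma final_dist_tri x y z : final_dist x z <= final_dist x y + final_dist y z.
Proof.
apply: hub_dist_tri => [a b c|a b|a b].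
- by rewrite -mulnDr leq_mul2l gdist_tri orbT.
- by rewrite /D gdist_sym.
- by rewrite addSn ltnS -mulnDr leq_mul2l height_lip orbT.
Qed.

Lemma final_dist_gt0 x y : x != y -> 0 < final_dist x y.
Proof.
move=> xy; rewrite /final_dist /hub_dist (negbTE xy) leq_min andbC /=.
rewrite muln_gt0 scale_gt0 lt0n; apply: contra xy => /eqP D0.
case: (gdist_case M G x y) => [DM|]; first by move: D0; rewrite /D DM; lia.
by rewrite -/D D0 => /(walk0_eq grG)->.
Qed.

Lemma final_dist_le x y : final_dist x y <= scale * M.
Proof.
rewrite /final_dist /hub_dist; case: ifP => // _.
by rewrite geq_min leq_mul2l gdist_leM orbT.
Qed.

(** Touched points end at least as high as in the play, so the detour between two of them is still
    no shorter than the answer. *)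
Lemma final_dist_answered x y w : answered M G (x, y, w) -> final_dist x y = scale * w.
Proof.
case=> wxy Dxy le_w; rewrite /final_dist /hub_dist.
have [xy|xy] := eqVneq x y; first by rewrite -Dxy xy gdist_refl muln0.
have touched a b r : a != b -> walk G a b r -> 0 < deg G a.
  by move=> ab wab; rewrite lt0n; apply: contra ab => /eqP/deg_eq0_walk/(_ wab)->.
have le_H a : 0 < deg G a -> play_height M G a <= H a.
  move=> a_gt0; apply/bigmax_leqP => b _.
  apply: leq_trans (_ : final_eta b - gdist M G b a <= _); last first.
    exact: (@leq_bigmax _ (fun b => final_eta b - gdist M G b a)).
  rewrite /final_eta; case: (posnP (deg G b)) => [b0|b_gt0]; last by lia.
  (* An untouched [b] is at distance [M >= radius 0] from [a], so dropping its height does not lower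
     that of [a]. *)
  rewrite gdist_isolated //; last by move=> ba; rewrite -ba b0 in a_gt0.
  by rewrite b0; have := radius_le 0; lia.
rewrite /D Dxy; apply/minn_idPl.
have := le_H _ (touched _ _ _ xy wxy).
have := le_H y (touched _ _ _ _ (walk_sym wxy)); rewrite eq_sym => /(_ xy) hy hx.
apply: leq_trans (_ : scale * (H x + H y) <= _); last by lia.
by rewrite leq_mul2l; apply/orP; right; lia.
Qed.

(** Both routes are long: [p] has height at least [L], and no walk joins [x] to [p], so their graph
    distance is [M >= L]. *)
Lemma final_dist_isolated x : x \in isolated G p -> scale * L <= final_dist p x.
Proof.
rewrite inE => /andP[/eqP x0 xp].
rewrite /final_dist /hub_dist eq_sym (negbTE xp) leq_min /D gdist_sym.
rewrite gdist_isolated //; last exact/eqP.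
rewrite leq_mul2l LM orbT /=; apply: leq_trans (leq_addr _ _).
apply: leqW; rewrite leq_mul2l; apply/orP; right.
by apply: leq_trans (height_ge _ _ _ _); rewrite /final_eta eqxx leq_maxl.
Qed.

Lemma sum_final_dist_ge : #|isolated G p| * (scale * L) <= \sum_x final_dist p x.
Proof.
rewrite -sum_nat_const big_mkcond; apply: leq_sum => x _.
by case: ifP => // /final_dist_isolated.
Qed.

(** No height reaches the untouched [v], which thus lies next to the hub; going through the hub
    costs at most [2 + scale * H x], and [sum_height] bounds the total. *)
Lemma sum_final_dist_le v : v \in isolated G p ->
  \sum_x final_dist v x <= #|T| * 2 + scale * (volume L + (size G).*2.*2).
Proof.
rewrite inE => /andP[/eqP v0 vp].
have Hv : H v = 0.
  apply/eqP; rewrite -leqn0; apply/bigmax_leqP => a _.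
  have [->|av] := eqVneq a v; first by rewrite /final_eta (negbTE vp) v0.
  rewrite gdist_sym gdist_isolated //; last by apply/eqP; rewrite eq_sym.
  by have := final_eta_le a; lia.
apply: leq_trans (_ : \sum_x (2 + scale * H x) <= _).
  apply: leq_sum => x _; rewrite /final_dist /hub_dist Hv; case: ifP => // _.
  by rewrite geq_min; apply/orP; right; lia.
rewrite big_split /= sum_nat_const leq_add2l -big_distrr /= leq_mul2l.
apply/orP; right; apply: leq_trans (sum_height grG final_eta_le) _.
apply: leq_trans (_ : \sum_a ((if a == p then volume L else 0) + (deg G a).*2) <= _).
  apply: leq_sum => a _; rewrite /final_eta.
  (* For a touched point, [deg + 1 <= 2 * deg]; so the total is charged to the degrees alone. *)
  have va : 0 < deg G a -> volume (radius (deg G a)) <= (deg G a).*2.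
    by move=> a_gt0; apply: leq_trans (volume_radius _) _; lia.
  have vol0 : volume 0 = 0 by rewrite /volume big_ord0.
  case: (posnP (deg G a)) va => [->|a_gt0 /(_ isT) va]; case: eqP => _;
    rewrite ?maxn0 ?max0n ?vol0 ?addn0 //.
  by rewrite /maxn; case: ifP => _; lia.
rewrite big_split /= -big_mkcond big_pred1_eq leq_add2l.
under eq_bigr do rewrite -muln2.
by rewrite -big_distrl /= -[leqRHS]muln2 leq_mul2r sum_deg.
Qed.

End FinalMetric.

(** * Simulating the algorithm on integer metrics *)

Definition bitlen (h : nat) : nat := \sum_(i < h) (2 ^ i <= h).

Lemma bitlen_code s : bitlen (CodeSeq.code s) = sumn s + size s.
Proof.
have lt_code t : CodeSeq.code t < 2 ^ (sumn t + size t).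
  elim: t => //= a t IHt; rewrite -addnA expnD ltn_pmul2l ?expn_gt0 // addnS expnS.
  by lia.
have le_code a t : 2 ^ (sumn (a :: t) + size t) <= CodeSeq.code (a :: t).
  elim: t a => [|b t IHt] a; first by rewrite /= !addn0 muln1.
  rewrite /= -addnA expnD leq_pmul2l ?expn_gt0 // addnS expnS.
  by have := IHt b; rewrite /=; lia.
case: s => [|a t]; first by rewrite /bitlen big_ord0.
set h := CodeSeq.code _; set l := sumn _ + _.
have lt_h : h < 2 ^ l := lt_code (a :: t).
have le_h : 2 ^ l.-1 <= h by have := le_code a t; rewrite /l /= addnS.
have l_gt0 : 0 < l by rewrite /l /= addnS.
have lh : l <= h by apply: leq_trans le_h; rewrite -{1}(prednK l_gt0) ltn_expl.
have small i : (2 ^ i <= h) = (i < l).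
  apply/idP/idP => [le_ih|lt_il]; last first.
    by apply: leq_trans le_h; rewrite leq_exp2l //; lia.
  by rewrite -(@ltn_exp2l 2) // (leq_ltn_trans le_ih).
rewrite /bitlen (eq_bigr (fun i : 'I_h => (i < l : nat))) ?sum_ltn // => i _.
by rewrite small.
Qed.

Lemma code_rcons s a :
  CodeSeq.code (rcons s a) = CodeSeq.code s + 2 ^ (bitlen (CodeSeq.code s) + a).
Proof.
rewrite bitlen_code; elim: s => [|b s IHs] /=; first by rewrite muln1.
rewrite IHs doubleD -addSn mulnDr -[(2 ^ _).*2]mul2n -expnS -expnD.
by congr (_ + 2 ^ _); lia.
Qed.

(** The value of [code_answers] on natural answers, each followed by its denominator 1. *)
Definition hist_code (s : seq nat) : nat :=
  CodeSeq.code (flatten [seq [:: a; 1] | a <- s]).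

Lemma hist_code_rcons s a :
  hist_code (rcons s a) = hist_code s + 2 ^ (bitlen (hist_code s) + a)
                          + 2 ^ (bitlen (hist_code s) + a.+2).
Proof.
rewrite /hist_code map_rcons flatten_rcons; set h := flatten _.
rewrite -cat_rcons cats1 code_rcons.
rewrite (code_rcons h); congr (_ + 2 ^ _).
by rewrite -code_rcons !bitlen_code sumn_rcons size_rcons; lia.
Qed.

Lemma code_answers_nat (s : seq nat) :
  code_answers [seq a%:R | a <- s]%R = hist_code s.
Proof.
rewrite /code_answers /hist_code -map_comp; congr (CodeSeq.code (flatten _)).
by apply: eq_map => a /=; rewrite -[(a%:R)%R]/(a%:Z%:~R)%R numq_int denq_int.
Qed.

(** * Integer metrics coded by numbers *)

Definition query_code (x y : nat) : nat := 2 ^ x * (2 * 2 ^ y).+1.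

Lemma query_codeE x y : CodeSeq.code [:: x; y] = query_code x y.
Proof. by rewrite /query_code /= muln1 mul2n. Qed.

(* A number [c] is read as a table, in base [base n], of the moves: the entry of
   a query is one plus the distance asked for, and 0 marks the outputs. *)
Definition base (n : nat) : nat := 2 * n.+1 ^ 2.

Definition table (n c m : nat) : nat := (c %/ base n ^ m) %% base n.

Lemma base_gt0 n : 0 < base n.
Proof. by rewrite muln_gt0 expn_gt0. Qed.

Lemma table_ex n m (t : nat -> nat) : (forall i, t i < base n) ->
  exists2 c, c < base n ^ m & forall i, i < m -> table n c i = t i.
Proof.
move=> t_lt; elim: m t t_lt => [|m IHm] t t_lt; first by exists 0.
have [c lt_c cP] := IHm (fun i => t i.+1) (fun i => t_lt _).
exists (c * base n + t 0); first by rewrite expnSr; have := t_lt 0; nia.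
case=> [_|i lt_im]; first by rewrite /table expn0 divn1 modnMDl modn_small.
by rewrite -cP // /table expnS divnMA divnMDl ?base_gt0 // (divn_small (t_lt 0)) addn0.
Qed.

Definition entry (n c x y : nat) : nat := table n c (query_code x y).

(** Entries are distances plus one: the value 1 stands for distance 0, and the strict inequality is
    the triangle inequality. [2 ^ x] is the code of the output [x]. *)
Definition metric_code (n c : nat) : bool :=
  [&& 0 < n,
      all (fun x => table n c (2 ^ x) == 0) (iota 0 n) &
      all (fun x => all (fun y =>
        [&& 0 < entry n c x y,
            nat_of_bool (entry n c x y == 1) == nat_of_bool (x == y),
            entry n c x y == entry n c y x &
            all (fun z => entry n c x z < entry n c x y + entry n c y z)
              (iota 0 n)]) (iota 0 n)) (iota 0 n)].

Lemma recursive_table k N C X : recursive k N -> recursive k C -> recursive k X ->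
  recursive k (fun v => table (N v) (C v) (X v)).
Proof.
move=> rN rC rX; have rB : recursive k (fun v => base (N v)) by rewrite /base; rec_arith.
apply: (recursive_mod _ rB); last by move=> v _; exact: base_gt0.
apply: recursive_div (recursive_exp rB rX) _ => // v _.
by rewrite expn_gt0 base_gt0.
Qed.

Lemma recursive_entry k N C X Y : recursive k N -> recursive k C ->
  recursive k X -> recursive k Y ->
  recursive k (fun v => entry (N v) (C v) (X v) (Y v)).
Proof.
by move=> *; apply: recursive_table => //; rewrite /query_code; rec_arith.
Qed.

Lemma recursive_metric_code :
  recursiveb 2 (fun v => metric_code (nth 0 v 0) (nth 0 v 1)).
Proof.
rewrite /metric_code; apply: recursiveb_and; first by rec_arith.
apply: recursiveb_and.
  apply: (recursiveb_all (recursive_proj _ _)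
    (P := fun u => table (nth 0 u 1) (nth 0 u 2) (2 ^ nth 0 u 0) == 0)).
  by apply: recursiveb_eq0; apply: recursive_table; rec_arith.
apply: (recursiveb_all (recursive_proj _ _) (P := fun u => all (fun y =>
  [&& 0 < entry (nth 0 u 1) (nth 0 u 2) (nth 0 u 0) y,
      nat_of_bool (entry (nth 0 u 1) (nth 0 u 2) (nth 0 u 0) y == 1) ==
        nat_of_bool (nth 0 u 0 == y),
      entry (nth 0 u 1) (nth 0 u 2) (nth 0 u 0) y ==
        entry (nth 0 u 1) (nth 0 u 2) y (nth 0 u 0) &
      all (fun z => entry (nth 0 u 1) (nth 0 u 2) (nth 0 u 0) z <
        entry (nth 0 u 1) (nth 0 u 2) (nth 0 u 0) y +
        entry (nth 0 u 1) (nth 0 u 2) y z)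
        (iota 0 (nth 0 u 1))]) (iota 0 (nth 0 u 1)))).
apply: (recursiveb_all (recursive_proj _ _) (P := fun u =>
  [&& 0 < entry (nth 0 u 2) (nth 0 u 3) (nth 0 u 1) (nth 0 u 0),
      nat_of_bool (entry (nth 0 u 2) (nth 0 u 3) (nth 0 u 1) (nth 0 u 0) == 1) ==
        nat_of_bool (nth 0 u 1 == nth 0 u 0),
      entry (nth 0 u 2) (nth 0 u 3) (nth 0 u 1) (nth 0 u 0) ==
        entry (nth 0 u 2) (nth 0 u 3) (nth 0 u 0) (nth 0 u 1) &
      all (fun z => entry (nth 0 u 2) (nth 0 u 3) (nth 0 u 1) z <
        entry (nth 0 u 2) (nth 0 u 3) (nth 0 u 1) (nth 0 u 0) +
        entry (nth 0 u 2) (nth 0 u 3) (nth 0 u 0) z)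
        (iota 0 (nth 0 u 2))])).
have re k i1 i2 i3 i4 : recursive k (fun u =>
    entry (nth 0 u i1) (nth 0 u i2) (nth 0 u i3) (nth 0 u i4)).
  by apply: recursive_entry; exact: recursive_proj.
apply: recursiveb_and; first by apply: recursiveb_leq => //; rec_arith.
apply: recursiveb_and.
  apply: recursiveb_eq; first by apply: recursiveb_eq => //; rec_arith.
  by apply: recursiveb_eq; rec_arith.
apply: recursiveb_and; first exact: recursiveb_eq.
apply: (recursiveb_all (recursive_proj _ _) (P := fun u =>
  entry (nth 0 u 3) (nth 0 u 4) (nth 0 u 2) (nth 0 u 0) <
  entry (nth 0 u 3) (nth 0 u 4) (nth 0 u 2) (nth 0 u 1) +
  entry (nth 0 u 3) (nth 0 u 4) (nth 0 u 1) (nth 0 u 0))).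
apply: recursiveb_leq; first exact: recursiveS.
exact: recursive_add.
Qed.

Definition is_nat_metric (n : nat) (d : 'I_n -> 'I_n -> nat) : Prop :=
  [/\ forall x y, (d x y == 0) = (x == y), forall x y, d x y = d y x &
      forall x y z, d x z <= d x y + d y z].

Lemma is_metric_nat (R : realType) n (d : 'I_n -> 'I_n -> nat) :
  is_nat_metric d -> is_metric (fun x y => (d x y)%:R : R)%R.
Proof.
case=> d0 dsym dtri; split=> [x y|x y|x y|x y z].
- exact: ler0n.
- by split=> [/eqP|->]; [rewrite pnatr_eq0 d0 => /eqP|apply/eqP; rewrite pnatr_eq0 d0].
- by rewrite dsym.
- by rewrite -natrD ler_nat.
Qed.

Definition table_dist (n c : nat) (x y : 'I_n) : nat := (entry n c x y).-1.
Arguments table_dist : clear implicits.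

Lemma metric_codeP n c : metric_code n c ->
  [/\ forall x : 'I_n, table n c (2 ^ x) = 0,
      forall x y : 'I_n, entry n c x y = (table_dist n c x y).+1 &
      is_nat_metric (table_dist n c)].
Proof.
case/and3P => _ /allP out_c /allP met_c.
have mem (x : 'I_n) : (x : nat) \in iota 0 n by rewrite mem_iota ltn_ord.
have met (x y : 'I_n) := and4P (allP (met_c _ (mem x)) _ (mem y)).
split=> [x|x y|]; first exact/eqP/out_c/mem.
  by rewrite prednK //; case: (met x y).
split=> [x y|x y|x y z].
- case: (met x y) => gt0 + _ _; rewrite /table_dist.
  rewrite -(inj_eq val_inj) /=.
  by case: (entry n c x y) gt0 => // -[|k] _ /=; case: (nat_of_ord x == y).
- by rewrite /table_dist; case: (met x y) => _ _ /eqP ->.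
- case: (met x y) => gt0 _ _ /allP /(_ _ (mem z)); case: (met y z) => gt0' _ _ _.
  by rewrite /table_dist; lia.
Qed.

Lemma metric_code_ex n (d : 'I_n.+1 -> 'I_n.+1 -> nat) : is_nat_metric d ->
  (forall x y, (d x y).+1 < base n.+1) ->
  exists c, [/\ c < base n.+1 ^ 4 ^ n.+1, metric_code n.+1 c &
                forall x y, table_dist n.+1 c x y = d x y].
Proof.
move=> [d0 dsym dtri] dB.
pose t m := if CodeSeq.decode m is [:: x; y] then (d (inord x) (inord y)).+1 else 0.
have tB m : t m < base n.+1.
  by rewrite /t; case: CodeSeq.decode => [|x [|y [|]]]; rewrite ?base_gt0.
have [c lt_c cP] := table_ex (4 ^ n.+1) tB; exists c.
have outE x : x < n.+1 -> table n.+1 c (2 ^ x) = 0.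
  move=> ltx; rewrite cP; last first.
    by apply: (@ltn_trans (2 ^ n.+1)); rewrite ?ltn_exp2l ?ltn_exp2r.
  by rewrite /t -[2 ^ x]muln1 -[2 ^ x * 1]/(CodeSeq.code [:: x]) CodeSeq.codeK.
have entE x y : x < n.+1 -> y < n.+1 ->
    entry n.+1 c x y = (d (inord x) (inord y)).+1.
  move=> ltx lty; rewrite /entry cP /t -?query_codeE ?CodeSeq.codeK //.
  rewrite query_codeE /query_code.
  (* Query codes are at most [2 ^ n * (2 * 2 ^ n + 1)], so [4 ^ n.+1] digits suffice. *)
  have -> : 4 ^ n.+1 = 4 * (2 ^ n * 2 ^ n) by rewrite expnS -expnMn.
  have : 2 ^ x <= 2 ^ n by rewrite leq_exp2l.
  have : 2 ^ y <= 2 ^ n by rewrite leq_exp2l.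
  by have : 0 < 2 ^ n by [rewrite expn_gt0]; nia.
split=> //.
  apply/and3P; split=> //.
    by apply/allP => x; rewrite mem_iota => /outE->.
  apply/allP => x; rewrite mem_iota add0n => /andP[_ ltx].
  apply/allP => y; rewrite mem_iota add0n => /andP[_ lty]; apply/and4P.
  rewrite !entE //; split=> //.
  - have -> : (x == y) = (d (inord x) (inord y) == 0).
      by rewrite d0 -(inj_eq val_inj) /= !inordK.
    by rewrite eqSS.
  - by rewrite dsym.
  - apply/allP => z; rewrite mem_iota add0n => /andP[_ ltz]; rewrite !entE //.
    by rewrite addSn ltnS addnS ltnS dtri.
by move=> x y; rewrite /table_dist entE //= !inord_val.
Qed.

(** * Runs on coded metrics and computability of the gap *)

Section Runs.
Variables (R : realType) (A : algorithm R).

Definition natR (s : seq nat) : seq R := [seq a%:R | a <- s]%R.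

Fixpoint nat_answers n (d : 'I_n.+1 -> 'I_n.+1 -> nat) (k : nat) : seq nat :=
  if k is k'.+1 then
    let h := nat_answers d k' in
    match A n (natR h) with
    | Query x y => rcons h (d x y)
    | Output _ => h
    end
  else [::].

Lemma answers_nat n (d : 'I_n.+1 -> 'I_n.+1 -> nat) k :
  answers A (fun x y => (d x y)%:R)%R k = natR (nat_answers d k).
Proof.
elim: k => //= k ->; case: (A n _) => // x y.
by rewrite /natR map_rcons.
Qed.

Lemma eq_nat_answers n (d d' : 'I_n.+1 -> 'I_n.+1 -> nat) k :
  (forall x y, d x y = d' x y) -> nat_answers d k = nat_answers d' k.
Proof. by move=> dd'; elim: k => //= k ->; case: (A n _) => // x y; rewrite dd'. Qed.

Lemma nat_answers_output n (d : 'I_n.+1 -> 'I_n.+1 -> nat) k p :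
  A n (natR (nat_answers d k)) = Output p ->
  forall j, nat_answers d (k + j) = nat_answers d k.
Proof.
by move=> out; elim=> [|j IHj]; rewrite ?addn0 // addnS /= IHj out.
Qed.

(** A query strictly increases the code, so a repeated code reveals an output. *)
Lemma hist_code_stable n (d : 'I_n.+1 -> 'I_n.+1 -> nat) k :
  hist_code (nat_answers d k) = hist_code (nat_answers d k.+1) ->
  exists p, A n (natR (nat_answers d k)) = Output p.
Proof.
rewrite /=; case: (A n _) => [x y|p _]; last by exists p.
rewrite hist_code_rcons -addnA -[LHS]addn0 => /eqP.
by rewrite eqn_add2l eq_sym addn_eq0 expn_eq0.
Qed.

Definition run (n c k : nat) : nat :=
  if n is m.+1 then
    if metric_code n c then hist_code (nat_answers (table_dist m.+1 c) k) else 0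
  else 0.

(** The entry of a query is the answer [a] plus one; its predecessor and successor are the [a] and
    [a + 2] of [hist_code_rcons]. *)
Definition run_step (h n c m : nat) : nat :=
  if table n c m == 0 then h
  else h + 2 ^ (bitlen h + (table n c m).-1) + 2 ^ (bitlen h + (table n c m).+1).

Lemma recursive_run_step : recursive 4 (fun v =>
  run_step (nth 0 v 0) (nth 0 v 1) (nth 0 v 2) (nth 0 v 3)).
Proof.
have rT : recursive 4 (fun v => table (nth 0 v 1) (nth 0 v 2) (nth 0 v 3)).
  by apply: recursive_table; exact: recursive_proj.
have rB : recursive 4 (fun v => bitlen (nth 0 v 0)).
  apply: (recursive_sum (recursive_proj _ _)
    (F := fun u => nat_of_bool (2 ^ nth 0 u 0 <= nth 0 u 1))).
  by rec_arith.
apply: recursive_if; first exact: recursiveb_eq0.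
  exact: recursive_proj.
by rec_arith.
Qed.

Lemma recursive_run : computable_algorithm A ->
  recursive 3 (fun v => run (nth 0 v 0) (nth 0 v 1) (nth 0 v 2)).
Proof.
move=> [e eP]; have [es esP] := recursive_run_step.
(* On an invalid code no iteration is made: the next-move function need not be defined on histories
   that no metric produces. *)
have [eN eNP] : recursive 3 (fun v =>
    nth 0 v 2 * metric_code (nth 0 v 0) (nth 0 v 1)).
  apply: recursive_mul; first exact: recursive_proj.
  by apply: (recursive_app2 (F := metric_code) recursive_metric_code);
    exact: recursive_proj.
pose eR := RPrim RZero
  (RComp es [:: RProj 1; RProj 2; RProj 3; RComp e [:: RProj 2; RProj 1]]).
have eRP n c k : metric_code n.+1 c -> rec_eval eR [:: k; n.+1; c] (run n.+1 c k).
  move=> cP; rewrite /run cP.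
  have [out_c ent_c met_c] := metric_codeP cP.
  elim: k => [|k IHk]; first by apply: eval_prim0; exact: eval_zero.
  apply: (eval_primS IHk); set d := table_dist _ _; set h := nat_answers d k.
  apply: (@eval_comp _ _ _
    [:: hist_code h; n.+1; c; code_move (A n (natR h))]).
    do 3![apply: evals_cons; first exact: eval_proj].
    apply: evals_cons; last exact: evals_nil.
    apply: (@eval_comp _ _ _ [:: n.+1; hist_code h]).
      by do 2![apply: evals_cons; first exact: eval_proj]; exact: evals_nil.
    have := eP n (fun x y => (d x y)%:R : R)%R k [seq a%:R | a <- h]%R
      (is_metric_nat R met_c).
    rewrite answers_nat code_answers_nat; apply.
    by rewrite -map_comp; apply: eq_map => a /=; rewrite ratr_nat.
  suff -> : hist_code (nat_answers d k.+1) =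
      run_step (hist_code h) n.+1 c (code_move (A n (natR h))) by exact: esP.
  rewrite /run_step /= -/h; case: (A n _) => [x y|p] /=; last first.
    by rewrite muln1 out_c eqxx.
  rewrite -[2 ^ _ * _]/(CodeSeq.code [:: x : nat; y : nat]) query_codeE.
  by rewrite -/(entry n.+1 c x y) ent_c /= hist_code_rcons.
exists (RComp eR [:: eN; RProj 0; RProj 1]) => v v3.
apply: (@eval_comp _ _ _ [:: nth 0 v 2 * metric_code (nth 0 v 0) (nth 0 v 1);
  nth 0 v 0; nth 0 v 1]).
  apply: evals_cons; first exact: eNP.
  by do 2![apply: evals_cons; first exact: eval_proj]; exact: evals_nil.
case: (nth 0 v 0) => [|n]; first by rewrite muln0; apply: eval_prim0; exact: eval_zero.
case cP: (metric_code n.+1 _); first by rewrite muln1; exact: eRP.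
by rewrite /run cP muln0; apply: eval_prim0; exact: eval_zero.
Qed.

(* Every metric used by the adversary has a code below [base n ^ 4 ^ n]; the
   numbers that code no metric have a constant run, hence never object. *)
Definition halted (n k : nat) : bool :=
  all (fun c => run n c k == run n c k.+1) (iota 0 (base n ^ 4 ^ n)).

Definition slack (n j : nat) : bool :=
  ~~ all (fun k => ~~ ((j.+1 ^ 2 * k.+1 <= n) && halted n k)) (iota 0 n).

(** As [slack n] is antitone in [j], counting its true values tells how far it holds; the successor
    keeps the value positive. *)
Definition gap (n : nat) : nat := (\sum_(j < n) slack n j).+1.

Lemma slackP n j :
  reflect (exists k, [/\ k < n, j.+1 ^ 2 * k.+1 <= n & halted n k]) (slack n j).
Proof.
apply: (iffP allPn) => [[k]|[k [lt_kn le_n hk]]].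
  by rewrite mem_iota negbK => /andP[_ lt_kn] /andP[]; exists k.
by exists k; rewrite ?mem_iota // negbK le_n.
Qed.

Lemma recursive_gap : computable_algorithm A -> recursive 1 (fun v => gap (nth 0 v 0)).
Proof.
move=> Acomp; have rr := recursive_run Acomp.
apply: recursiveS; apply: (recursive_sum (recursive_proj _ _)
  (F := fun u => nat_of_bool (slack (nth 0 u 1) (nth 0 u 0)))).
apply: recursiveb_neg; apply: (recursiveb_all (recursive_proj _ _) (P := fun u =>
  ~~ (((nth 0 u 1).+1 ^ 2 * (nth 0 u 0).+1 <= nth 0 u 2) &&
      halted (nth 0 u 2) (nth 0 u 0)))).
apply/recursiveb_neg/recursiveb_and; first by rec_arith.
have rB : recursive 3 (fun u => base (nth 0 u 2) ^ 4 ^ nth 0 u 2).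
  by rewrite /base; rec_arith.
apply: (recursiveb_all rB (P := fun u =>
  run (nth 0 u 3) (nth 0 u 0) (nth 0 u 1) ==
  run (nth 0 u 3) (nth 0 u 0) (nth 0 u 1).+1)).
by apply: recursiveb_eq; apply: (recursive_app3 rr); rec_arith.
Qed.

Lemma halted_output n k (d : 'I_n.+1 -> 'I_n.+1 -> nat) :
  is_nat_metric d -> (forall x y, (d x y).+1 < base n.+1) -> halted n.+1 k ->
  exists p, A n (natR (nat_answers d k)) = Output p.
Proof.
move=> met_d dB /allP hk; have [c [lt_c cP cd]] := metric_code_ex met_d dB.
have := hk c; rewrite mem_iota add0n lt_c => /(_ isT); rewrite /run cP.
rewrite !(eq_nat_answers _ cd) => /eqP; exact: hist_code_stable.
Qed.

Lemma query_bound_halted q n : query_bound A q -> halted n.+1 (q n.+1).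
Proof.
move=> qP; apply/allP => c _; rewrite /run; case cP: (metric_code _ _) => //.
have [_ _ met_c] := metric_codeP cP.
have [p] := qP n _ (is_metric_nat R met_c); rewrite /outputs_within answers_nat.
by move=> /= ->.
Qed.

(** If [m] indices satisfy [slack n], one of them is at least [m - 1]. *)
Lemma gap_slack n : 1 < gap n -> exists k,
  [/\ k < n, (gap n).-1 ^ 2 * k.+1 <= n & halted n k].
Proof.
rewrite /gap /= ltnS => gap_gt0; set m := \sum_(j < n) _ in gap_gt0 *.
suff [j le_mj /slackP[k [lt_kn le_n hk]]] : exists2 j, m <= j.+1 & slack n j.
  exists k; split=> //; apply: leq_trans le_n.
  by rewrite leq_mul2r leq_exp2r // le_mj orbT.
apply: contrapT => no_j; suff: m <= m.-1 by lia.
rewrite {1}/m; apply: leq_trans (_ : \sum_(j < n) (j < m.-1) <= _).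
  apply: leq_sum => j _; case sj: (slack n j) => //; rewrite lt0b ltnNge.
  by apply/negP => le_mj; apply: no_j; exists (nat_of_ord j) => //; lia.
apply: leq_trans (sum_leq_lt n 0 m.-1) _; by rewrite subn0.
Qed.

(** All runs have halted after [q n] moves, so [q n] witnesses [slack n j] for every [j < J]. This
    makes the gap tend to infinity. *)
Lemma gap_ge n J q : query_bound A q -> J ^ 2 * (q n).+1 <= n -> J <= n -> q n < n ->
  0 < n -> J <= gap n.
Proof.
move=> qP le_n Jn lt_qn; case: n => // n in le_n Jn lt_qn * => _.
rewrite /gap; apply: leqW; apply: leq_trans (_ : \sum_(j < n.+1) (j < J) <= _).
  by rewrite sum_ltn.
apply: leq_sum => j _; case: ltnP => // lt_jJ; rewrite lt0b; apply/slackP.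
exists (q n.+1); split=> //; last exact: query_bound_halted.
by apply: leq_trans le_n; rewrite leq_mul2r leq_exp2r // lt_jJ orbT.
Qed.

End Runs.

(** * The adversary *)

Section Adversary.
Variables (R : realType) (A : algorithm R) (n : nat).
Let N := n.+1.
(** Exceeds every detour offered during the first [N] moves, as [answered_new] requires. *)
Let M := N.*2.+2.
Let edges := seq ('I_N * 'I_N * nat).

(* Answers given, pairs queried with their unscaled answers, graph. *)
Fixpoint play (k : nat) : seq nat * edges * edges :=
  if k is k'.+1 then
    let: (h, qs, G) := play k' in
    match A n (natR R h) with
    | Query x y => (rcons h (N * play_dist M G x y),
                    (x, y, play_dist M G x y) :: qs, play_next M G x y)
    | Output _ => (h, qs, G)
    end
  else ([::], [::], [::]).

Lemma play_inv k : k <= N -> let: (_, qs, G) := play k in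
  [/\ size G <= k, graded G & forall q, q \in qs -> answered M G q].
Proof.
elim: k => //= k IHk lt_kN; have := IHk (ltnW lt_kN).
case: (play k) => -[h qs] G [sG grG ansG].
case: (A n _) => [x y|p]; last by split=> //; exact: leqW.
split; [|exact: graded_play_next|move=> q].
  exact: leq_trans (size_play_next _ _ _ _) _.
rewrite inE => /predU1P[->|/ansG]; last exact: answered_old.
by apply: answered_new; rewrite ltnS leqW // leq_double (leq_ltn_trans sG).
Qed.

(** Any [d] that agrees with the recorded answers produces the same history, so the metric may be
    chosen after the output. *)
Lemma play_answers k (d : 'I_N -> 'I_N -> nat) :
  let: (h, qs, _) := play k in
  (forall x y w, (x, y, w) \in qs -> d x y = N * w) -> nat_answers A d k = h.
Proof.
elim: k => //= k; case: (play k) => -[h qs] G IHk.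
case E: (A n _) => [x y|p] dP.
  rewrite IHk => [|a b w abw]; last by apply: dP; rewrite inE abw orbT.
  by rewrite E (dP x y (play_dist M G x y)) // inE eqxx.
by rewrite IHk // E.
Qed.

Lemma adversary k L : halted A N k -> k.*2.+1 < N -> L <= N ->
  exists (d : 'I_N -> 'I_N -> nat) p v,
  [/\ is_nat_metric d, A n (natR R (nat_answers A d k)) = Output p,
      (N - k.*2.+1) * (N * L) <= \sum_x d p x &
      \sum_x d v x <= N * (2 + volume L + k.*2.*2)].
Proof.
move=> hk lt_kN LN; have kN : k <= N by lia.
have := play_inv kN; have := @play_answers k.
case: (play k) => -[h qs] G ansE [sG grG ansG].
have GM : (size G).+1 <= M by rewrite /M; lia.
have LM : L <= M by rewrite /M; lia.
pose d p := final_dist M N G p L.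
have met p : is_nat_metric (d p).
  split=> [x y|x y|x y z]; [|exact: final_dist_sym|exact: final_dist_tri].
  have [->|xy] := eqVneq x y; first by rewrite /d final_dist_refl.
  by apply/negbTE; rewrite -lt0n; apply: final_dist_gt0.
have dB p x y : (d p x y).+1 < base N.
  (* The choice of [base] rests on [N * M + 1 < 2 * (N + 1) ^ 2]. *)
  have := @final_dist_le _ M N G p L x y; rewrite -/(d p) /base /M; nia.
have runE p : nat_answers A (d p) k = h.
  by apply: ansE => x y w /ansG; exact: final_dist_answered.
(* By [runE] the history does not depend on [p]: the output is read off with [ord0] in its place and
   only then selects the metric. *)
have [p outp] := halted_output (met ord0) (dB ord0) hk.
have cardI : N - k.*2.+1 <= #|isolated G p|.
  have := card_isolated G p; rewrite card_ord leq_subLR => /leq_trans; apply.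
  by rewrite -addnA addnC leq_add2r add1n ltnS leq_double.
have /card_gt0P[v vI] : 0 < #|isolated G p|.
  by apply: leq_trans cardI; rewrite subn_gt0.
exists (d p), p, v; split=> //.
- by rewrite runE -(runE ord0).
- by apply: leq_trans (sum_final_dist_ge N G p LM); rewrite leq_mul2r cardI orbT.
- apply: leq_trans (sum_final_dist_le grG GM LM (ltn0Sn n) vI) _.
  by rewrite card_ord -mulnDr leq_mul2l addnA leq_add2l !leq_double sG orbT.
Qed.

End Adversary.

(** * From costs to the approximation ratio *)

Section Ratio.
Local Open Scope ring_scope.
Variables (R : realType) (A : algorithm R).

Lemma output_unique n (d : 'I_n.+1 -> 'I_n.+1 -> nat) j k p p' :
  A n (natR R (nat_answers A d j)) = Output p ->
  A n (natR R (nat_answers A d k)) = Output p' -> p = p'.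
Proof.
move=> outj outk; have := nat_answers_output outk j.
by rewrite addnC (nat_answers_output outj) => E; move: outj; rewrite E outk => -[].
Qed.

(** The absolute value allows replacing [min_cost] by the cost of any competitor [v], whatever the
    sign of [g]. *)
Lemma approximate_nat (g : nat -> R) n (d : 'I_n.+1 -> 'I_n.+1 -> nat) k p v :
  approximate A g -> is_nat_metric d ->
  A n (natR R (nat_answers A d k)) = Output p ->
  (\sum_x d p x)%N%:R <= `|g n.+1| * (\sum_x d v x)%N%:R.
Proof.
move=> appr met out; have [j [p' []]] := appr n _ (is_metric_nat R met).
rewrite /outputs_within answers_nat => /output_unique/(_ out) ->.
have costE x : cost (fun x y => (d x y)%:R : R) x = (\sum_y d x y)%N%:R.
  by rewrite /cost natr_sum.
rewrite costE => /le_trans; apply.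
have min_ge0 : 0 <= min_cost (fun x y => (d x y)%:R : R).
  by apply: le_bigmin => [|x _]; rewrite costE.
apply: le_trans (ler_wpM2r min_ge0 (ler_norm _)) _.
by rewrite ler_wpM2l // -costE bigmin_le.
Qed.

Lemma gap_log_le (n : nat) (g : nat -> R) : (64 <= n.+1)%N -> (2 < gap A n.+1)%N ->
  approximate A g ->
  (gap A n.+1)%:R * ln (n.+1%:R : R) <= 512 * (10 * `|g n.+1|).
Proof.
move=> N64 gap_gt2 appr; set N := n.+1 in N64 gap_gt2 *.
have [k [lt_kN le_N hk]] := gap_slack (ltnW gap_gt2).
set m := (gap A N).-1 in le_N.
have gapE : gap A N = m.+1 by rewrite /m prednK // ltnW // ltnW.
have m2 : (2 <= m)%N by rewrite -ltnS -gapE.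
(* Base 64 makes [8 ^ L], the bound on the cost of lifting the output, at most the square root of
   [N]. *)
set L := trunc_log 64 N.
have leL : (64 ^ L <= N)%N by exact: trunc_logP.
have ltL : (N < 64 ^ L.+1)%N by exact: trunc_log_ltn.
have L_gt0 : (0 < L)%N by rewrite trunc_log_gt0.
have LN : (L <= N)%N by apply: leq_trans leL; exact/ltnW/ltn_expl.
have mk : (m * k.+1 <= N)%N.
  by apply: leq_trans le_N; rewrite leq_mul2r -{1}[m]expn1 leq_pexp2l ?orbT // ltnW.
(* From [m >= 2], at least half of the points remain untouched and distinct from the output. *)
have k4 : (4 * k.+1 <= N)%N.
  by apply: leq_trans le_N; rewrite leq_mul2r -[4%N]/(2 ^ 2)%N leq_exp2r // m2 orbT.
have mL : (m * 8 ^ L <= N)%N.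
  rewrite -(@leq_exp2r _ _ 2) // expnMn -expnM mulnC [(L * 2)%N]mulnC expnM expnS.
  rewrite expn1 leq_mul //; apply: leq_trans le_N.
  by rewrite leq_pmulr.
have [|d [p [v [met out le_p le_v]]]] := adversary (L := L) hk _ LN; first lia.
set P := (\sum_x d p x)%N in le_p; set V := (\sum_x d v x)%N in le_v.
(* The ratio of the costs: [P] is at least [N ^ 2 * L / 2], while [m * V] is at most [5 * N ^ 2] by
   [mk] and [mL]. *)
have le_VP : (L * m * V <= 10 * P)%N.
  have vL := volume_le L.
  have le_mV : (m * V <= 5 * N * N)%N.
    apply: leq_trans (_ : m * (N * (2 + volume L + k.*2.*2)) <= _)%N.
      by rewrite leq_mul2l le_v orbT.
    have : (m * (2 + volume L + k.*2.*2) <= 5 * N)%N.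
      apply: leq_trans (_ : m * (4 * k.+1 + 8 ^ L) <= _)%N.
        by rewrite leq_mul2l; apply/orP; right; lia.
      by rewrite mulnDr; lia.
    by rewrite mulnCA [(5 * N * N)%N]mulnC leq_mul2l => ->; rewrite orbT.
  have : (N * N * L <= 2 * P)%N.
    apply: leq_trans (_ : 2 * ((N - k.*2.+1) * (N * L)) <= _)%N; last first.
      by rewrite leq_mul2l le_p orbT.
    rewrite !mulnA leq_mul2r; apply/orP; right; rewrite leq_mul2r; apply/orP; right.
    by lia.
  move=> le_NP; rewrite -mulnA.
  apply: leq_trans (_ : L * (5 * N * N) <= _)%N; first by rewrite leq_mul2l le_mV orbT.
  by rewrite mulnC -!mulnA -[10%N]/(5 * 2)%N -mulnA leq_mul2l mulnA le_NP.
have P_gt0 : (0 < P)%N.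
  apply: leq_trans le_p; rewrite !muln_gt0 L_gt0 !andbT subn_gt0; lia.
have apprP := approximate_nat v appr met out; rewrite -/P -/V -/N in apprP.
have LmR : (L * m)%N%:R <= 10 * `|g N|.
  rewrite leNgt; apply/negP => lt_g.
  have V_gt0 : 0 < V%:R :> R.
    rewrite ltr0n lt0n; apply/negP => /eqP V0.
    by move: apprP; rewrite V0 mulr0 lern0 -leqn0 leqNgt P_gt0.
  have : (L * m * V)%N%:R <= 10 * P%:R :> R by rewrite -natrM ler_nat.
  rewrite natrM; apply/negP; rewrite -ltNge.
  apply: le_lt_trans (_ : 10 * (`|g N| * V%:R) < _); first by rewrite ler_wpM2l.
  by rewrite mulrA ltr_pM2r.
(* Crude estimates suffice: [ln 64 <= 64] and [L + 1 <= 2 * L]. *)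
have lnN : ln (N%:R : R) <= (128 * L)%N%:R.
  apply: le_trans (_ : ln ((64 ^ L.+1)%N%:R : R) <= _).
    by rewrite ler_ln ?posrE ?ltr0n ?expn_gt0 // ler_nat ltnW.
  rewrite natrX lnXn ?ltr0n //.
  apply: le_trans (_ : 64 *+ L.+1 <= _).
    rewrite lerMn2r /=; have -> : 64%:R = 1 + 63 :> R by rewrite nat1r.
    by apply: le_trans (le_ln1Dx _) _; [exact: lt_le_trans (ltrN10 _) _|rewrite lerDr].
  by rewrite -mulrnA ler_nat; lia.
apply: le_trans (ler_wpM2l (ler0n _ _) LmR).
apply: le_trans (ler_wpM2l (ler0n _ _) lnN) _.
have fin a b : (0 < a -> a.+1 * (128 * b) <= 512 * (b * a))%N by nia.
by rewrite -!natrM ler_nat gapE fin // ltnW.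
Qed.

End Ratio.

Local Open Scope classical_set_scope.
Local Open Scope ring_scope.

Theorem theorem22 (R : realType) (A : algorithm R)
  (A_computable : computable_algorithm A)
  (A_queries : makes_sublinear_queries A) :
  exists f : nat -> nat,
    [/\ forall n : nat, (0 < n)%N -> (0 < f n)%N,
        computable_posfun f,
        f n @[n --> \oo] --> \oo
      & forall g : nat -> R,
          g =o_\oo (fun n : nat => (f n)%:R * ln (n%:R : R)) ->
          ~ approximate A g].
Proof.
have gap_oo : gap A n @[n --> \oo] --> \oo.
  have [q [qP /eqoP qo]] := A_queries; apply/cvgnyPge => J.
  (* From [c * q n <= n] and [c <= n], both [J ^ 2 * q n] and [J ^ 2] are at most [n / 2]. *)
  pose c := (2 * (J ^ 2).+1)%N.
  have c_gt0 : 0 < c%:R^-1 :> R by rewrite invr_gt0 ltr0n.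
  apply: filterS2 (qo _ c_gt0) (nbhs_infty_ge (c + J)) => n.
  rewrite !normr_nat mulrC ler_pdivlMr ?ltr0n // -natrM ler_nat => le_q le_n.
  by apply: (gap_ge qP); move: le_q le_n; rewrite /c; nia.
exists (gap A); split=> //.
  by have [e eP] := recursive_gap A_computable; exists e => n _; exact: (eP [:: n]).
move=> g /eqoP go appr.
(* Twice the constant of [gap_log_le]: the positive quantity [gap * ln] would be at most half of
   itself. *)
have c_gt0 : 0 < 1024 * 10 :> R by rewrite mulr_gt0 ?ltr0n.
have e_gt0 : 0 < (1024 * 10)^-1 :> R by rewrite invr_gt0.
have /cvgnyPge/(_ 3%N) gap3 := gap_oo.
have [n [[le_g le3n] le64n]] :=
  filter_ex (filterI (filterI (go _ e_gt0) gap3) (nbhs_infty_ge 64)).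
case: n => // n in le_g le3n le64n *.
have := gap_log_le le64n le3n appr.
have gl_gt0 : 0 < (gap A n.+1)%:R * ln (n.+1%:R : R).
  by rewrite mulr_gt0 ?ltr0n // ln_gt0 // ltr1n (leq_trans _ le64n).
move: le_g => /=; rewrite [X in _ * X]gtr0_norm // mulrC ler_pdivlMr //.
by move: (_ * ln _) (`|_|) gl_gt0 => x y x0; lra.
Qed.
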